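(* Let $(X,p_1),(Y,p_2),(Z,q)$ be asymmetric normed spaces and let $T\in\mathcal{L}^2_{p_1,p_2;q}(X,Y;Z)$ be a continuous bilinear operator. If $T$ is $q^s$-precompact, then the adjoint operator $T^\flat:Z^\flat_q\to\mathcal{L}^2_{p_1,p_2}(X,Y)$ is $\|\cdot|$-precompact, i.e. $T^\flat(B_{q^\flat})$ is a precompact subset of $\mathcal{L}^2_{p_1,p_2}(X,Y)$ with respect to the extended quasi-metric $\delta$ induced by the norm $\|\cdot|=\|\cdot|_{p_1,p_2;u}$.
   Context: An asymmetric norm on a real vector space $X$ is a functional $p:X\to[0,\infty)$ such that $p(x)=p(-x)=0\Rightarrow x=0$, $p(\alpha x)=\alpha p(x)$ and $p(x+y)\le p(x)+p(y)$ for all $x,y\in X$, $\alpha\ge 0$. It carries the topology $\tau(p)$ of the quasi-metric $d_p(x,y)=p(y-x)$: neighborhoods of $x$ are the sets containing a ball $B_{d_p}(x,r)=\{y: d_p(x,y)<r\}$, $r>0$. Put $B_p=\{x: p(x)\le 1\}$ and $p^s(x)=\max\{p(x),p(-x)\}$. On $\mathbb{R}$ let $u(\alpha)=\max\{\alpha,0\}$. $\mathcal{L}^2_{p_1,p_2;q}(X,Y;Z)$ is the set of bilinear operators $X\times Y\to Z$ continuous from the product of $\tau(p_1),\tau(p_2)$ to $\tau(q)$, and $\mathcal{L}^2_{p_1,p_2}(X,Y)=\mathcal{L}^2_{p_1,p_2;u}(X,Y;\mathbb{R})$ is the cone of continuous bilinear forms, normed by $\|b|=\|b|_{p_1,p_2;u}=\sup\{b(x,y):(x,y)\in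 B_{p_1}\times B_{p_2}\}$. This cone carries the extended quasi-metric $\delta(b_1,b_2)=\|b_2-b_1|$ if $b_2-b_1\in\mathcal{L}^2_{p_1,p_2}(X,Y)$ and $\delta(b_1,b_2)=\infty$ otherwise. The dual $Z^\flat_q$ is the cone of all linear functionals $\psi:Z\to\mathbb{R}$ continuous from $\tau(q)$ to $\tau(u)$, normed by $q^\flat(\psi)=\sup\{\psi(z): z\in Z,\ q(z)\le 1\}$; $B_{q^\flat}=\{\psi\in Z^\flat_q: q^\flat(\psi)\le 1\}$. The adjoint of $T$ is $T^\flat:Z^\flat_q\to\mathcal{L}^2_{p_1,p_2}(X,Y)$, $(T^\flat\psi)(x,y)=\psi(T(x,y))$. A subset $W$ of a set with an (extended) quasi-pseudometric $d$ is $d$-precompact if for every $\varepsilon>0$ there is a finite subset $F\subseteq W$ with $W\subseteq\bigcup_{w\in F}\{v: d(w,v)<\varepsilon\}$. The bilinear operator $T$ is $q^s$-precompact if $T(B_{p_1}\times B_{p_2})$ is precompact with respect to the metric $q^s(z'-z)$ on $Z$. *)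

(* Defs.v *)
From mathcomp Require Import all_boot all_order all_algebra.
From mathcomp Require Import all_classical all_reals.
From mathcomp Require Import ereal.

Set Implicit Arguments.
Unset Strict Implicit.
Unset Printing Implicit Defensive.

Import Order.TTheory GRing.Theory Num.Theory.

Local Open Scope classical_set_scope.
Local Open Scope ring_scope.

Record asymmetric_norm (R : realType) (X : lmodType R) (p : X -> R) : Prop :=
  AsymmetricNorm {
    asymnorm_ge0 : forall x, 0 <= p x;
    asymnorm_eq0 : forall x, p x = 0 -> p (- x) = 0 -> x = 0;
    asymnormZ : forall (a : R) x, 0 <= a -> p (a *: x) = a * p x;
    asymnormD : forall x y, p (x + y) <= p x + p y
  }.

Section AsymmetricNorms.
Variable R : realType.
Implicit Types X Y Z : lmodType R.

Definition qdist X (p : X -> R) (x y : X) : R := p (y - x).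

Definition qball X (p : X -> R) (x : X) (r : R) : set X :=
  [set y | qdist p x y < r].

(* Neighbourhood filter of x for tau(p). *)
Definition qnbhs X (p : X -> R) (x : X) : set_system X :=
  filter_from [set r : R | 0 < r] (qball p x).

Definition unit_ball X (p : X -> R) : set X := [set x | p x <= 1].

Definition symnorm X (p : X -> R) (x : X) : R := Num.max (p x) (p (- x)).

Definition upos (a : R^o) : R := Num.max a 0.

Definition qcontinuous X Z (p : X -> R) (q : Z -> R) (f : X -> Z) : Prop :=
  forall x, f @ qnbhs p x --> qnbhs q (f x).

(* Joint continuity, from the product of tau(p1) and tau(p2) to tau(q). *)
Definition qcontinuous2 X Y Z (p1 : X -> R) (p2 : Y -> R) (q : Z -> R)
    (f : X -> Y -> Z) : Prop :=
  forall x y, (fun w : X * Y => f w.1 w.2) @ filter_prod (qnbhs p1 x) (qnbhs p2 y)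
    --> qnbhs q (f x y).

(* The product in [bilinear_for] lives in [Type]; this is its [Prop] version. *)
Definition is_bilinear X Y Z (f : X -> Y -> Z) : Prop :=
  (forall y, linear (f ^~ y)) /\ (forall x, linear (f x)).

Definition bilinear_ops X Y Z (p1 : X -> R) (p2 : Y -> R) (q : Z -> R) :
    set (X -> Y -> Z) :=
  [set T | is_bilinear T /\ qcontinuous2 p1 p2 q T].

Definition bilinear_forms X Y (p1 : X -> R) (p2 : Y -> R) :
    set (X -> Y -> R^o) :=
  bilinear_ops p1 p2 upos.

(* The suprema below are taken in [\bar R], so they are meaningful whether or
   not the set of values is bounded. *)
Definition form_norm X Y (p1 : X -> R) (p2 : Y -> R) (b : X -> Y -> R^o) :
    \bar R :=
  ereal_sup [set (b w.1 w.2)%:E | w in unit_ball p1 `*` unit_ball p2].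

Definition form_dist X Y (p1 : X -> R) (p2 : Y -> R)
    (b1 b2 : X -> Y -> R^o) : \bar R :=
  let b := fun x y => b2 x y - b1 x y in
  if b \in bilinear_forms p1 p2 then form_norm p1 p2 b else +oo%E.

Definition dual Z (q : Z -> R) : set (Z -> R^o) :=
  [set psi | linear psi /\ qcontinuous q upos psi].

Definition dual_norm Z (q : Z -> R) (psi : Z -> R^o) : \bar R :=
  ereal_sup [set (psi z)%:E | z in unit_ball q].

Definition dual_ball Z (q : Z -> R) : set (Z -> R^o) :=
  [set psi | dual q psi /\ (dual_norm q psi <= 1)%E].

Definition adjoint X Y Z (T : X -> Y -> Z) (psi : Z -> R^o) : X -> Y -> R^o :=
  fun x y => psi (T x y).

(* Finitely many small balls centred in W cover W; the library's [precompact]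
   (contained in a compact set) is a different notion. *)
Definition qprecompact (V : Type) (d : V -> V -> \bar R) (W : set V) : Prop :=
  forall eps : R, 0 < eps ->
    exists F : set V, [/\ finite_set F, F `<=` W &
      W `<=` \bigcup_(w in F) [set v | (d w v < eps%:E)%E]].

Definition symdist Z (q : Z -> R) (z z' : Z) : \bar R :=
  (symnorm q (z' - z))%:E.

Definition qs_precompact_op X Y Z (p1 : X -> R) (p2 : Y -> R) (q : Z -> R)
    (T : X -> Y -> Z) : Prop :=
  qprecompact (symdist q) [set T w.1 w.2 | w in unit_ball p1 `*` unit_ball p2].

End AsymmetricNorms.

(* Main.v *)
Require Import Defs.
From mathcomp Require Import all_boot all_order all_algebra.
From mathcomp Require Import all_classical all_reals.
From mathcomp Require Import ereal.
From mathcomp Require Import lra ring.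

(** By homogeneity, a functional in the dual ball is dominated by [q], and a
    bilinear form bounded above on [B_p1 x B_p2] is dominated by a multiple of
    [p1 x * p2 y], hence continuous.  Given a finite [q^s]-net [s] of
    [T(B_p1 x B_p2)], the values of the dual ball at the points of [s] are
    bounded, so finitely many functionals approximate all the others on [s]
    within [e].  If [phi] and [psi] are [e]-close on [s] and [z] is [e]-close to
    [v] in [s], then
    [psi z - phi z = psi (z - v) + (psi v - phi v) + phi (v - z)] is less than
    [3 e]; only the upper bounds [psi, phi <= q] are used, but at both [z - v]
    and [v - z], which is why the net must be taken for the symmetrization. *)

Import Order.TTheory GRing.Theory Num.Theory.

Local Open Scope classical_set_scope.
Local Open Scope ring_scope.

(* The values at each point of [s] are sorted into finitely many cells of
   width [e]. *)
Lemma pointwise_bounded_finite_net {R : realType} {I : eqType} (s : seq I)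
    (A : set (I -> R)) (e : R) :
  0 < e -> (forall i, exists M, forall f, A f -> `|f i| <= M) ->
  exists F : set (I -> R), [/\ finite_set F, F `<=` A &
    forall f, A f -> exists2 g, F g & {in s, forall i, `|f i - g i| < e}].
Proof.
move=> e0; elim: s A => [|i s IH] A bA.
  have [[f Af]|/asboolPn/forallp_asboolPn A0] := pselect (exists f, A f).
    by exists [set f]; split => // [_ -> //|g _]; exists f.
  by exists set0; split => // f /A0.
have [M bM] := bA i.
pose cell n := A `&` [set f | Num.truncn ((f i + M) / e) = n].
have code_ge0 f : A f -> 0 <= (f i + M) / e.
  move=> /bM; rewrite ler_norml => /andP[lefM _].
  by rewrite divr_ge0 ?(ltW e0)// -lerBlDr sub0r.
(* The net for the rest of the list is sought inside each cell, so that its centres belong to [A]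
   and also agree with [f] on the cell at [i]. *)
have /choice[G GP] n : exists F : set (I -> R), [/\ finite_set F, F `<=` cell n &
    forall f, cell n f -> exists2 g, F g & {in s, forall j, `|f j - g j| < e}].
  by apply: IH => j; have [N bN] := bA j; exists N => f [/bN].
(* As [f i + M] lies between [0] and [M + M], only cells of index below [N] contain members of
   [A]. *)
pose N := (Num.truncn ((M + M) / e)).+1.
exists (\bigcup_(n in `I_N) G n); split.
- by apply: bigcup_finite => [|n _]; [exact: finite_II | have [] := GP n].
- by move=> f [n _ Gf]; have [_ /(_ _ Gf)[]] := GP n.
move=> f Af; set n := Num.truncn ((f i + M) / e).
have [_ Gcell /(_ f (conj Af erefl))[g Gg fg]] := GP n.
have [Ag gn] := Gcell _ Gg.
exists g.
  exists n => //; rewrite /= /N ltnS; apply: le_truncn.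
  rewrite ler_pM2r ?invr_gt0// lerD2r.
  by apply: le_trans (bM _ Af); exact: ler_norm.
move=> j; rewrite inE => /predU1P[->|]; last exact: fg.
(* Both [f i + M] and [g i + M] lie in the half-open interval from [n * e] to [(n + 1) * e], hence
   the strict bound. *)
have /andP[fl fu] := truncn_itv (code_ge0 _ Af).
have /andP[gl gu] := truncn_itv (code_ge0 _ Ag).
move: gl gu; rewrite gn -/n => gl gu; rewrite -/n in fl fu.
move: fl fu gl gu; rewrite !ler_pdivlMr// !ltr_pdivrMr// -natr1 mulrDl mul1r.
by move=> *; rewrite ltr_norml; apply/andP; split; lra.
Qed.

Section AsymmetricNormFacts.
Context {R : realType}.
Implicit Types X Y Z : lmodType R.

Lemma asymnorm0 {X} {p : X -> R} : asymmetric_norm p -> p 0 = 0.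
Proof. by move=> hp; rewrite -(scale0r 0) (asymnormZ hp) ?mul0r. Qed.

(** If [p x] is positive, rescale [x] to the unit sphere; [p] may also vanish at a nonzero [x],
    which calls for a separate argument. *)
Lemma le_mul_asymnorm {X} {p : X -> R} (f : X -> R) (M : R) :
  asymmetric_norm p -> (forall a x, 0 <= a -> f (a *: x) = a * f x) ->
  (forall x, p x <= 1 -> f x <= M) -> forall x, f x <= M * p x.
Proof.
move=> hp fZ fM x.
have [px0|px_neq0] := eqVneq (p x) 0.
  (* [x] spans a ray inside the unit ball, along which [f] is bounded above. *)
  rewrite px0 mulr0 leNgt; apply/negP => fx0.
  have M0 : 0 <= M.
    by rewrite -[0](mul0r (f 0)) -fZ// scale0r fM// asymnorm0.
  have t0 : 0 <= (M + 1) / f x by rewrite divr_ge0 ?ltW// ltr_wpDl.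
  have := fM (((M + 1) / f x) *: x).
  rewrite (asymnormZ hp)// px0 mulr0 ler01 => /(_ isT).
  by rewrite fZ// divfK ?gt_eqF//; lra.
have px_gt0 : 0 < p x by rewrite lt_def px_neq0 (asymnorm_ge0 hp).
have := fM ((p x)^-1 *: x).
rewrite (asymnormZ hp) ?invr_ge0 ?(ltW px_gt0)// mulVf// lexx => /(_ isT).
by rewrite fZ ?invr_ge0 ?(ltW px_gt0)// ler_pdivrMl// mulrC.
Qed.

Lemma dual_ball_le {Z} {q : Z -> R} {psi : Z -> R^o} :
  asymmetric_norm q -> dual_ball q psi -> forall z, psi z <= q z.
Proof.
move=> hq [[lpsi _] npsi] z; rewrite -[q z]mul1r.
apply: (le_mul_asymnorm (psi : Z -> R)) => // [a x _|x qx].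
  exact: (scalable_linear lpsi).
rewrite -lee_fin; apply: le_trans npsi.
by apply: ereal_sup_ubound; exists x.
Qed.

(** Domination by [q] is applied at [z] and at [- z]. This bounds the values of the dual ball at
    each net point. *)
Lemma dual_ball_norm_le {Z} {q : Z -> R} {psi : Z -> R^o} :
  asymmetric_norm q -> dual_ball q psi ->
  forall z, `|psi z : R| <= symnorm q z.
Proof.
move=> hq dpsi z; have [[lpsi _] _] := dpsi.
rewrite ler_norml /symnorm lerNl !le_max.
rewrite (dual_ball_le hq dpsi) andbT orbC.
have <- : psi (- z) = - psi z.
  by rewrite -[- z]scaleN1r (scalable_linear lpsi); exact: mulN1r.
by rewrite (dual_ball_le hq dpsi).
Qed.

Lemma is_bilinear_adjoint {X Y Z} {T : X -> Y -> Z} {psi : Z -> R^o} :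
  is_bilinear T -> linear psi -> is_bilinear (adjoint T psi).
Proof.
by move=> [Tl Tr] lpsi; split=> [y|x] a u v; rewrite /adjoint/= ?Tl ?Tr lpsi.
Qed.

Lemma is_bilinearB {X Y} {b c : X -> Y -> R^o} :
  is_bilinear b -> is_bilinear c -> is_bilinear (fun x y => b x y - c x y).
Proof.
move=> [bl br] [cl cr]; split=> [y|x] a u v /=.
  by rewrite bl cl scalerBr addrACA opprD.
by rewrite br cr scalerBr addrACA opprD.
Qed.

Lemma adjoint_bilinear_forms {X Y Z} {p1 : X -> R} {p2 : Y -> R} {q : Z -> R}
    {T : X -> Y -> Z} {psi : Z -> R^o} :
  bilinear_ops p1 p2 q T -> dual q psi -> bilinear_forms p1 p2 (adjoint T psi).
Proof.
move=> [bT cT] [lpsi cpsi]; split; first exact: is_bilinear_adjoint.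
by move=> x y; exact: cvg_comp (cT x y) (cpsi (T x y)).
Qed.

(** Continuous forms make up only a cone, and [form_dist] is infinite when a difference leaves it;
    this criterion puts differences of adjoints back into the cone. *)
Lemma bounded_bilinear_forms {X Y} {p1 : X -> R} {p2 : Y -> R}
    {b : X -> Y -> R^o} (M : R) :
  asymmetric_norm p1 -> asymmetric_norm p2 -> is_bilinear b ->
  (forall x y, p1 x <= 1 -> p2 y <= 1 -> b x y <= M) -> bilinear_forms p1 p2 b.
Proof.
move=> hp1 hp2 bb bM; split=> // x0 y0.
have [bl br] := bb.
(* Rescale one variable at a time: the bound in [y] is [M * p1 x], which itself comes from rescaling
   in [x]. *)
have b_le x y : b x y <= M * p1 x * p2 y.
  apply: (le_mul_asymnorm (b x : Y -> R)) => // [a v _|v p2v].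
    exact: (scalable_linear (br x)).
  apply: (le_mul_asymnorm (b ^~ v : X -> R)) => // [a u _|u p1u].
    exact: (scalable_linear (bl v)).
  exact: bM.
have M0 : 0 <= M.
  have := bM 0 0; rewrite (asymnorm0 hp1) (asymnorm0 hp2) => /(_ ler01 ler01).
  by rewrite -(subr0 (0 : Y)) (zmod_morphism_linear (br _)) subrr.
move=> P [e /= e0 eP].
(* With [r <= 1], the three terms of the expansion below add up to at most [r * (M * K)]; the [+ 1]
   in the denominator of [r] covers [M = 0]. *)
set K := 1 + p1 x0 + p2 y0.
have K0 : 0 < K.
  by rewrite /K -addrA ltr_wpDr// addr_ge0 ?(asymnorm_ge0 hp1) ?(asymnorm_ge0 hp2).
have D0 : 0 < M * K + 1 by rewrite ltr_wpDl// mulr_ge0// ltW.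
pose r := Num.min 1 (e / (M * K + 1)).
have r0 : 0 < r by rewrite lt_min ltr01 divr_gt0.
have r1 : r <= 1 by rewrite ge_min lexx.
have re : r * (M * K) < e.
  have : r * (M * K + 1) <= e.
    by rewrite -ler_pdivlMr// /r ge_min lexx orbT.
  by rewrite mulrDr mulr1; lra.
exists (qball p1 x0 r, qball p2 y0 r); first by split; exists r.
move=> [x y] [/= hx hy]; apply: eP; rewrite /qball /qdist/= /upos.
rewrite /qball /qdist/= in hx hy.
rewrite gt_max e0 andbT.
(* Increments enter only as [x - x0] and [y - y0], since the balls do not control [p1] and [p2] at
   their opposites. *)
have -> : b x y - b x0 y0
    = b (x - x0) (y - y0) + b x0 (y - y0) + b (x - x0) y0.
  rewrite !(zmod_morphism_linear (br _)) !(zmod_morphism_linear (bl _)).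
  ring.
apply: le_lt_trans re.
have -> : r * (M * K) = M * r + M * p1 x0 * r + M * r * p2 y0 by rewrite /K; ring.
have p1x := asymnorm_ge0 hp1 (x - x0); have p2y := asymnorm_ge0 hp2 (y - y0).
rewrite !lerD//.
- apply: le_trans (b_le _ _) _; rewrite -mulrA ler_wpM2l//.
  by rewrite -[leRHS]mulr1 ler_pM// ltW// (lt_le_trans hy).
- apply: le_trans (b_le _ _) _; rewrite ler_wpM2l ?(ltW hy)//.
  by rewrite mulr_ge0// (asymnorm_ge0 hp1).
- apply: le_trans (b_le _ _) _; rewrite ler_wpM2r ?(asymnorm_ge0 hp2)//.
  by rewrite ler_wpM2l// ltW.
Qed.

End AsymmetricNormFacts.

Theorem theorem4p3 (R : realType) (X Y Z : lmodType R)
    (p1 : X -> R) (p2 : Y -> R) (q : Z -> R)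
    (hp1 : asymmetric_norm p1) (hp2 : asymmetric_norm p2)
    (hq : asymmetric_norm q)
    (T : X -> Y -> Z) (hT : bilinear_ops p1 p2 q T)
    (hpc : qs_precompact_op p1 p2 q T) :
  adjoint T @` dual_ball q `<=` bilinear_forms p1 p2 /\
  qprecompact (form_dist p1 p2) (adjoint T @` dual_ball q).
Proof.
split=> [_ [psi [dpsi _] <-]|eps eps0]; first exact: adjoint_bilinear_forms hT dpsi.
(* The pointwise bound [3 * e] becomes non-strict in the supremum, so it has to stay strictly below
   [eps]. *)
pose e := eps / 4.
have e0 : 0 < e by rewrite divr_gt0.
have [S [/finite_seqP[s ->] _ Scover]] := hpc _ e0.
have [|F [finF Fball Fnet]] :=
    pointwise_bounded_finite_net s (dual_ball q : set (Z -> R)) _ e0.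
  by move=> z; exists (symnorm q z) => psi dpsi; exact: dual_ball_norm_le.
exists (adjoint T @` F); split; [exact: finite_image | exact: image_subset |].
move=> _ [psi dpsi <-]; have [phi Fphi close] := Fnet _ dpsi.
have dphi := Fball _ Fphi.
exists (adjoint T phi); first by exists phi.
have [[lpsi _] _] := dpsi; have [[lphi _] _] := dphi.
have diff_le x y : p1 x <= 1 -> p2 y <= 1 ->
    adjoint T psi x y - adjoint T phi x y <= 3 * e.
  move=> px py; have [|v sv] := Scover (T x y); first by exists (x, y).
  rewrite /= /symdist lte_fin /symnorm gt_max opprB => /andP[q1 q2].
  have /ltr_normlW := close _ sv.
  have := dual_ball_le hq dpsi (T x y - v).
  have := dual_ball_le hq dphi (v - T x y).
  rewrite (zmod_morphism_linear lpsi) (zmod_morphism_linear lphi) /adjoint.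
  by move=> *; lra.
rewrite /= /form_dist ifT.
  apply: (@le_lt_trans _ _ (3 * e)%:E); last by rewrite lte_fin /e; lra.
  by apply/ereal_supP => _ [[x y] [/= px py] <-]; rewrite lee_fin diff_le.
apply/mem_set/(bounded_bilinear_forms _ hp1 hp2 _ diff_le).
by have [bT _] := hT; apply: is_bilinearB; exact: is_bilinear_adjoint.
Qed.
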